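(* Let $k\ge2$ be an integer, let $F_k$ be the free group on $k$ generators $x_1,\dots,x_k$, and let $\chi_1=\sum_{i=1}^k (x_i+x_i^{-1})\in\mathbb{C}F_k$. Then $\chi_1$ is a $p$-zero divisor for all real $p>2$.
   Context: For a discrete group $G$, a function $G\to\mathbb{C}$ is written as a formal sum $\sum_{g\in G}a_g g$. $\mathbb{C}G$ is the set of finitely supported functions, and for real $p\ge1$, $L^p(G)=\{\sum a_g g:\sum|a_g|^p<\infty\}$. For $\alpha=\sum a_g g\in L^1(G)$ and $\beta=\sum b_g g\in L^p(G)$, $\alpha*\beta=\sum_{g\in G}\bigl(\sum_{h\in G}a_{gh^{-1}}b_h\bigr)g\in L^p(G)$. A nonzero $\alpha\in L^1(G)$ is a $p$-zero divisor if there exists $\beta\in L^p(G)\setminus0$ with $\alpha*\beta=0$. *)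

(* Defs.v *)
From HB Require Import structures.
From mathcomp Require Import all_boot all_order all_algebra.
From mathcomp Require Import all_classical all_reals all_analysis.
From mathcomp Require Import complex.

Set Implicit Arguments.
Unset Strict Implicit.
Unset Printing Implicit Defensive.

Import Order.TTheory GRing.Theory Num.Theory.

Local Open Scope ring_scope.
Local Open Scope complex_scope.

(* The free group on T: freely reduced words, multiplied by concatenation     *)
(* followed by free reduction. The letter (t, false) stands for the generator *)
(* t and (t, true) for its inverse.                                           *)
Section FreeGroup.
Variable T : choiceType.

Definition letter := (T * bool)%type.

Definition letter_inv (a : letter) : letter := (a.1, ~~ a.2).

Definition reduced (w : seq letter) : bool :=
  sorted (fun a b => b != letter_inv a) w.

Record freeGroup := FreeGroup {
  word :> seq letter;
  word_reduced : reduced word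
}.

HB.instance Definition _ := [isSub for word].
HB.instance Definition _ := [Choice of freeGroup by <:].

(* The reduced form of a :: w, for w reduced. *)
Definition push (a : letter) (w : seq letter) : seq letter :=
  if w is b :: w' then (if b == letter_inv a then w' else a :: w) else [:: a].

Definition word_mul (u v : seq letter) : seq letter := foldr push v u.

Definition word_inv (w : seq letter) : seq letter := rev (map letter_inv w).

Lemma letter_invK : involutive letter_inv.
Proof. by case=> t b; rewrite /letter_inv /= negbK. Qed.

Lemma push_reduced a w : reduced w -> reduced (push a w).
Proof.
case: w => [|b w] //=; case: ifP => [_|ba]; first exact: path_sorted.
by move=> bw; rewrite /= ba.
Qed.

Lemma pushK a w : reduced w -> push a (push (letter_inv a) w) = w.
Proof.
case: w => [|b w] /=; first by rewrite eqxx.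
rewrite letter_invK; case: eqP => [->|_ _]; last by rewrite /= eqxx.
by case: w => [|c w] //= /andP[/negPf ->].
Qed.

Lemma push_cons a w : reduced (a :: w) -> push a w = a :: w.
Proof. by case: w => [|b w] //= /andP[/negPf ->]. Qed.

Lemma word_mul_reduced u v : reduced v -> reduced (word_mul u v).
Proof. by move=> rv; elim: u => //= a u; exact: push_reduced. Qed.

Lemma word_mul_push a u w : reduced w ->
  word_mul (push a u) w = push a (word_mul u w).
Proof.
case: u => [|b u] //= rw; case: eqP => [->|] //=.
by rewrite pushK// word_mul_reduced.
Qed.

Lemma word_mulA u v w : reduced w ->
  word_mul u (word_mul v w) = word_mul (word_mul u v) w.
Proof. by move=> rw; elim: u => //= a u ->; rewrite word_mul_push. Qed.

Lemma word_mulw0 u : reduced u -> word_mul u [::] = u.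
Proof.
elim: u => //= a u IHu rau; rewrite IHu ?push_cons//.
exact: path_sorted rau.
Qed.

Lemma word_inv_reduced w : reduced w -> reduced (word_inv w).
Proof.
rewrite /reduced /word_inv rev_sorted sorted_map; apply: sub_sorted => a b /=.
by apply: contra => /eqP /(can_inj letter_invK) ->; rewrite letter_invK.
Qed.

Lemma word_invK : involutive word_inv.
Proof.
by move=> w; rewrite /word_inv map_rev revK -map_comp map_id_in// => a _;
  exact: letter_invK.
Qed.

Lemma word_mulVw w : reduced w -> word_mul (word_inv w) w = [::].
Proof.
rewrite /word_mul /word_inv; elim: w => //= a w IHw raw.
rewrite rev_cons foldr_rcons /= letter_invK eqxx IHw//.
exact: path_sorted raw.
Qed.

Definition free_one : freeGroup := @FreeGroup [::] isT.

Definition free_mul (u v : freeGroup) : freeGroup :=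
  FreeGroup (word_mul_reduced u (word_reduced v)).

Definition free_inv (u : freeGroup) : freeGroup :=
  FreeGroup (word_inv_reduced (word_reduced u)).

Lemma free_mulA : associative free_mul.
Proof. by move=> u v w; apply/val_inj; exact/word_mulA/word_reduced. Qed.

Lemma free_mul1 : left_id free_one free_mul.
Proof. by move=> u; exact/val_inj. Qed.

Lemma free_mulr1 : right_id free_one free_mul.
Proof. by move=> u; apply/val_inj; exact/word_mulw0/word_reduced. Qed.

Lemma free_mulV : left_inverse free_one free_inv free_mul.
Proof. by move=> u; apply/val_inj; exact/word_mulVw/word_reduced. Qed.

Lemma free_mulrV : right_inverse free_one free_inv free_mul.
Proof.
by move=> u; rewrite -{1}[u](_ : free_inv (free_inv u) = u) ?free_mulV//;
  apply/val_inj; exact: word_invK.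
Qed.

HB.instance Definition _ := isGroup.Build freeGroup
  free_mulA free_mul1 free_mulr1 free_mulV free_mulrV.

Definition free_gen (t : T) : freeGroup := @FreeGroup [:: (t, false)] isT.

End FreeGroup.

(* The formal sum \sum_g a_g g is encoded as the function g |-> a_g.          *)
Section Lp.
Variables (R : realType) (G : groupType).

Definition Lp (p : R) : set (G -> R[i]) :=
  [set a | summable [set: G] (fun g => (ComplexField.Normc.normc (a g) `^ p)%:E)].

(* Sums of absolutely summable families, as differences of sums of            *)
(* nonnegative families; meaningless for other families.                      *)
Definition real_sum (u : G -> R) : R :=
  fine (\esum_(g in [set: G]) ((EFin \o u)^\+ g)%E) -
  fine (\esum_(g in [set: G]) ((EFin \o u)^\- g)%E).

Definition complex_sum (u : G -> R[i]) : R[i] :=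
  real_sum (fun g => complex.Re (u g)) +i* real_sum (fun g => complex.Im (u g)).

Definition convolution (a b : G -> R[i]) : G -> R[i] :=
  fun g => complex_sum (fun h => a (g * h^-1)%g * b h).

Definition p_zero_divisor (p : R) (a : G -> R[i]) : Prop :=
  [/\ Lp 1 a, a <> 0 &
      exists b : G -> R[i], [/\ Lp p b, b <> 0 & convolution a b = 0]].

Definition point_mass (g : G) : G -> R[i] := fun h => (h == g)%:R.

End Lp.

Definition chi1 (R : realType) (k : nat) : freeGroup 'I_k -> R[i] :=
  \sum_(i < k) (point_mass R (free_gen i) + point_mass R (free_gen i)^-1%g).

Arguments chi1 R k g : clear implicits.

(* Main.v *)
Require Import Defs.
From mathcomp Require Import all_boot all_order all_algebra.
From mathcomp Require Import all_classical all_reals all_analysis.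
From mathcomp Require Import complex zify.
From mathcomp Require finmap.
Local Open Scope ring_scope.

Set Implicit Arguments.
Unset Strict Implicit.
Unset Printing Implicit Defensive.
Import Order.TTheory GRing.Theory Num.Theory.

(** The zero divisor is paired with the radial function whose value on a word
    of length n is phi n. Multiplication by a letter lengthens a nonempty
    reduced word in q = 2k - 1 cases and shortens it in one, so chi1 kills the
    function as soon as phi 1 = 0 and q * phi (n + 2) + phi n = 0: take
    phi (2m) = (- 1 / q)^m and phi = 0 on odd lengths. There are at most
    2 q^n words of length n, and |phi n|^p <= q^(- n p / 2), so the p-th powers
    are dominated by a geometric series of ratio q^(1 - p / 2) < 1. *)

Definition letter_elt (T : choiceType) (l : letter T) : freeGroup T :=
  @FreeGroup T [:: l] isT.

Lemma free_gen_inv (T : choiceType) (t : T) :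
  (free_gen t)^-1%g = letter_elt (t, true).
Proof. exact/val_inj. Qed.

Lemma letter_eltV_mul (T : choiceType) (l : letter T) (g : freeGroup T) :
  word ((letter_elt l)^-1 * g)%g = push (letter_inv l) g.
Proof. by []. Qed.

(** * Convolution by finite sums of point masses *)

Section PointFamilies.
Variables (R : realType) (I : finType).

Lemma esum_point_family (T : choiceType) (t : I -> T) (v : T -> R) :
  (forall x, 0 <= v x) ->
  \esum_(x in [set: T]) ((\sum_i (x == t i)%:R) * v x)%:E =
  (\sum_i v (t i))%:E.
Proof.
move=> v0.
under eq_esum do rewrite mulr_suml -sumEFin.
rewrite esum_sum; last by move=> *; rewrite lee_fin mulr_ge0.
rewrite -sumEFin; apply: eq_bigr => i _.
rewrite -(@esum_set1 _ _ (t i) (fun x => (v x)%:E)) ?lee_fin//.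
rewrite [RHS]esum_mkcond; apply: eq_esum => x _.
by case: eqP => [->|/= xt]; [rewrite mem_set// mul1r|rewrite memNset// mul0r].
Qed.

(** No summability of [v] is assumed, since only the finitely many points [t i] contribute. The
    weight is nonnegative, so it factors out of the positive and negative parts. *)
Lemma real_sum_point_family (G : groupType) (t : I -> G) (v : G -> R) :
  real_sum (fun x => (\sum_i (x == t i)%:R) * v x) = \sum_i v (t i).
Proof.
have n0 x : 0 <= \sum_i (x == t i)%:R :> R by exact: sumr_ge0.
have npos x (w : G -> R) :
    Order.max (((\sum_i (x == t i)%:R) * w x)%:E) 0%:E =
    ((\sum_i (x == t i)%:R) * (w^\+)%R x)%:E.
  by rewrite -EFin_max /funrpos maxr_pMr// mulr0.
rewrite /real_sum.
under eq_esum do rewrite funeposE npos.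
under [X in _ - fine X]eq_esum do
  rewrite funenegE -EFinN -mulrN (npos _ (\- v)) funrposN.
rewrite !(esum_point_family t) /=.
- rewrite -sumrB; apply: eq_bigr => i _.
  by rewrite -[in RHS](funrposBneg v).
- exact: funrneg_ge0.
- exact: funrpos_ge0.
Qed.

Lemma sum_point_massE (G : groupType) (s : I -> G) x :
  (\sum_i point_mass R (s i)) x = (\sum_i (x == s i)%:R)%:C%C.
Proof.
rewrite fct_sumE rmorph_sum; apply: eq_bigr => i _.
by rewrite rmorph_nat.
Qed.

(** As a function of [h], the factor at [g * h^-1] is supported on the points [(s i)^-1 * g]. Its
    values are real, so real and imaginary parts separate. *)
Lemma convolution_point_masses (G : groupType) (s : I -> G) (b : G -> R[i]) g :
  convolution (\sum_i point_mass R (s i)) b g = \sum_i b ((s i)^-1 * g)%g.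
Proof.
rewrite /convolution /complex_sum.
have E h : (\sum_i point_mass R (s i)) (g * h^-1)%g =
    (\sum_i (h == (s i)^-1 * g)%g%:R)%:C%C.
  rewrite sum_point_massE; congr (_%:C)%C; apply: eq_bigr => i _.
  congr (nat_of_bool _)%:R; apply/eqP/eqP => [<-|->].
    by rewrite invgM invgK mulgVK.
  by rewrite invgM invgK mulVKg.
have ReE (r : R) z : complex.Re (r%:C%C * z) = r * complex.Re z.
  by case: z => x y /=; rewrite mul0r subr0.
have ImE (r : R) z : complex.Im (r%:C%C * z) = r * complex.Im z.
  by case: z => x y /=; rewrite mul0r addr0.
under eq_fun do rewrite E ReE.
under [in X in (_ +i* X)%C]eq_fun do rewrite E ImE.
rewrite (real_sum_point_family _ (fun h => complex.Re (b h))).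
rewrite (real_sum_point_family _ (fun h => complex.Im (b h))).
by apply/eqP; rewrite eq_complex !raddf_sum /= !eqxx.
Qed.

End PointFamilies.

(** * Counting reduced words by length *)

Section Spheres.
Variable T : finType.

Definition extend_word (w : seq (letter T)) : seq (seq (letter T)) :=
  [seq a :: w | a <- enum {: T * bool} & reduced (a :: w)].

Fixpoint reduced_words (n : nat) : seq (seq (letter T)) :=
  if n is n'.+1 then flatten (map extend_word (reduced_words n')) else [:: [::]].

Lemma mem_reduced_words n w :
  (w \in reduced_words n) = reduced w && (size w == n).
Proof.
elim: n w => [|n IHn] w.
  by rewrite inE; case: w => //= a w; rewrite andbF.
apply/flatten_mapP/idP => [[u + /mapP[a + ->]]|].
  by rewrite IHn mem_filter => /andP[_ /= /eqP ->] /andP[-> _] /=.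
case: w => [|a w]; rewrite ?andbF// => /andP[raw /= wn]; exists w.
  by rewrite IHn [reduced w](path_sorted raw).
by apply/mapP; exists a; rewrite // mem_filter raw mem_enum.
Qed.

(** Only the inverse of [c] is forbidden in front of [c]. *)
Lemma size_extend_cons c w : reduced (c :: w) ->
  size (extend_word (c :: w)) = (#|T| * 2).-1.
Proof.
move=> rcw; rewrite size_map (_ : [seq a <- _ | _] = enum (predC1 (letter_inv c))).
  by rewrite -cardE cardC1 card_prod card_bool.
rewrite enumT; apply: eq_filter => a.
move: rcw; rewrite /reduced /= inE => ->; rewrite andbT; congr (~~ _).
by apply/eqP/eqP => ->; rewrite letter_invK.
Qed.

Lemma size_reduced_words n :
  size (reduced_words n.+1) = (#|T| * 2 * (#|T| * 2).-1 ^ n)%N.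
Proof.
elim: n => [|n IHn].
  by rewrite /= cats0 size_map filter_predT -cardE card_prod card_bool muln1.
rewrite [LHS]/= size_flatten /shape -map_comp.
have /eq_in_map -> :
    {in reduced_words n.+1, size \o extend_word =1 fun=> (#|T| * 2).-1}.
  by move=> w; rewrite mem_reduced_words; case: w => [|c w]; rewrite ?andbF//;
    case/andP => + _; exact: size_extend_cons.
rewrite sumnE big_map big_const_seq count_predT iter_addn_0 IHn.
by rewrite expnSr mulnC mulnA.
Qed.

(** The factor 2 lets one bound cover the empty word too; for longer words,
    [#|T| * 2 <= 2 * (#|T| * 2).-1] suffices. *)
Lemma size_reduced_words_le n :
  (size (reduced_words n) <= 2 * (#|T| * 2).-1 ^ n)%N.
Proof.
case: n => [//|n]; rewrite size_reduced_words expnS mulnA leq_mul2r.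
by case: #|T| => [|m]; rewrite ?orbT//; apply/orP; right; lia.
Qed.

Lemma count_sphere_le (s : seq (freeGroup T)) n : uniq s ->
  (count (fun g : freeGroup T => size g == n) s <= 2 * (#|T| * 2).-1 ^ n)%N.
Proof.
move=> us; apply: leq_trans (size_reduced_words_le n).
rewrite -size_filter -(size_map (@word T)); apply: uniq_leq_size.
  by rewrite (map_inj_uniq val_inj) filter_uniq.
move=> w /mapP[g + ->]; rewrite mem_filter mem_reduced_words => /andP[-> _].
by rewrite word_reduced.
Qed.

Section Growth.
Variables (R : realType) (x : R).
Hypotheses (x0 : 0 <= x) (xq1 : x * (#|T| * 2).-1%:R < 1).

Lemma sum_expr_size_le (s : seq (freeGroup T)) : uniq s ->
  \sum_(g <- s) x ^+ size g <= 2 / (1 - x * (#|T| * 2).-1%:R).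
Proof.
move=> us; set y := x * _.
have y1 : 0 < 1 - y by rewrite subr_gt0.
pose N := (\max_(g <- s) size g).+1.
(* Each term becomes a sum over [n < N] with only its own length contributing, so exchanging the
   sums groups the words by length. *)
rewrite (eq_big_seq (fun g : freeGroup T =>
    \sum_(0 <= n < N | n == size g) x ^+ n));
  last first.
  move=> g gs; rewrite big_nat1_eq leq0n /= ltnS.
  by rewrite ifT//; exact: leq_bigmax_seq.
rewrite (exchange_big_dep xpredT)//= ler_pdivlMr//.
apply: (@le_trans _ _ ((\sum_(0 <= n < N) 2 * y ^+ n) * (1 - y))).
  rewrite ler_pM2r//; apply: ler_sum => n _.
  rewrite big_const_seq iter_addr addr0 -[leLHS]mulr_natl exprMn mulrCA.
  rewrite (mulrC (x ^+ n)) ler_wpM2r ?exprn_ge0// -natrX -natrM ler_nat.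
  rewrite (eq_count (a2 := fun g : freeGroup T => size g == n)) => [|g];
    last exact: eq_sym.
  exact: count_sphere_le.
(* Multiplied by [1 - y], the geometric sum telescopes to [1 - y ^+ N], which is at most 1. *)
rewrite -mulr_sumr -mulrA ler_piMr// mulrC big_mkord.
by rewrite -opprB mulNr -subrX1 opprB gerBl exprn_ge0// mulr_ge0.
Qed.

(** The infinite sum is the supremum of its finite partial sums, and these share the bound of
    [sum_expr_size_le]. *)
Lemma esum_expr_size_lty :
  (\esum_(g in [set: freeGroup T]) (x ^+ size g)%:E < +oo)%E.
Proof.
apply: le_lt_trans (ltry (2 / (1 - x * (#|T| * 2).-1%:R))).
apply: ge_ereal_sup => _ [A [finA _] <-].
by rewrite fsumEFin// lee_fin fsbig_finite//= sum_expr_size_le// finmap.fset_uniq.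
Qed.

End Growth.

(** The letter [l = c] cancels and every other one lengthens the word. The inverse appears because
    convolving with the point mass at [l] evaluates at [l^-1 * g]. *)
Lemma sum_letters_push (V : zmodType) (f : nat -> V) c (w : seq (letter T)) :
  \sum_(l : letter T) f (size (push (letter_inv l) (c :: w))) =
  f (size w) + f (size w).+2 *+ (#|T| * 2).-1.
Proof.
rewrite (bigD1 c)//= letter_invK eqxx; congr (_ + _).
rewrite (eq_bigr (fun=> f (size w).+2)) => [|l lc].
  by rewrite sumr_const cardC1 card_prod card_bool.
by rewrite letter_invK eq_sym (negPf lc).
Qed.

End Spheres.

(** * The radial profile and its decay *)

Section Spherical.
Variable R : realType.

(** This is [phi] when [a = 1 / q]. *)
Definition spherical (a : R) (n : nat) : R :=
  if odd n then 0 else (- a) ^+ n./2.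

Lemma sphericalSS a n : spherical a n.+2 = - a * spherical a n.
Proof. by rewrite /spherical /= negbK; case: odd; rewrite ?mulr0// exprS. Qed.

(** For even [n] both sides equal [a] to the power [n * p / 2]; for odd [n] the left side is 0. *)
Lemma powR_norm_spherical_le a p n : 0 <= a -> 0 < p ->
  `|spherical a n| `^ p <= (a `^ (p / 2)) ^+ n.
Proof.
move=> a0 p0; rewrite /spherical; case: ifPn => [_|/even_halfK nE].
  by rewrite normr0 powR0 ?gt_eqF// exprn_ge0// powR_ge0.
rewrite normrX normrN ger0_norm// -[in leRHS]nE -!powR_mulrn ?powR_ge0//.
by rewrite -!powRrM -muln2 natrM mulrCA mulrAC mulfK ?pnatr_eq0// mulrC mulrA.
Qed.

Lemma powR_inv_mul_lt1 (q p : R) : 1 < q -> 2 < p -> q^-1 `^ (p / 2) * q < 1.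
Proof.
move=> q1 p2; have q0 : 0 < q by exact: lt_trans q1.
rewrite -powR_inv1 ?ltW// -powRrM -{2}[q]powRr1 ?ltW//.
rewrite -powRD ?(gt_eqF q0) ?implybT//.
have e0 : -1 * (p / 2) + 1 < 0.
  by rewrite mulN1r addrC subr_lt0 ltr_pdivlMr// mul1r.
(* Monotonicity in the exponent gives only a weak inequality; equality is excluded because [q > 1]
   and the exponent is negative. *)
rewrite lt_neqAle -[in leRHS](powRr0 q) ler_powR ?ltW// andbT powR_eq1.
by rewrite gt_eqF//= lt_eqF// ltNge ltW.
Qed.

End Spherical.

(** * The element [chi1] and the function it annihilates *)

Section Chi1.
Variables (R : realType) (k : nat).

Lemma chi1E : chi1 R k = \sum_(l : letter 'I_k) point_mass R (letter_elt l).
Proof.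
rewrite -(pair_big xpredT xpredT (fun i b => point_mass R (letter_elt (i, b)))).
by apply: eq_bigr => i _; rewrite big_bool /= addrC free_gen_inv.
Qed.

Lemma normc_real (x : R) : ComplexField.Normc.normc x%:C%C = `|x|.
Proof. by rewrite /ComplexField.Normc.normc /= expr0n addr0 sqrtr_sqr. Qed.

Lemma chi1_L1 : Lp 1 (chi1 R k).
Proof.
rewrite /Lp /= /summable.
rewrite (eq_esum (b := fun g : freeGroup 'I_k =>
  ((\sum_(l : letter 'I_k) (g == letter_elt l)%:R) * 1)%:E)).
  by rewrite (esum_point_family _ (v := fun=> 1)) ?ltry.
move=> g _; rewrite chi1E sum_point_massE normc_real ger0_norm ?sumr_ge0//.
by rewrite mulr1 powRr1 ?sumr_ge0// abse_EFin ger0_norm ?sumr_ge0.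
Qed.

(** The coefficient at the first generator is at least 1. *)
Lemma chi1_neq0 : (0 < k)%N -> chi1 R k <> 0.
Proof.
move=> k0; rewrite chi1E => /(congr1 (@^~ (letter_elt (Ordinal k0, false)))).
rewrite sum_point_massE /= => /(congr1 (@complex.Re R)) /= /eqP.
by rewrite (bigD1 (Ordinal k0, false))//= gt_eqF// ltr_pwDl// sumr_ge0.
Qed.

Let q : R := (k * 2).-1%:R.

Definition spherical_function (g : freeGroup 'I_k) : R[i] :=
  (spherical q^-1 (size g))%:C%C.

Lemma convolution_chi1_spherical : (0 < k)%N ->
  convolution (chi1 R k) spherical_function = 0.
Proof.
move=> k0; have qn0 : q != 0 by rewrite pnatr_eq0; lia.
apply/funext => g; rewrite chi1E convolution_point_masses.
under eq_bigr do rewrite /spherical_function letter_eltV_mul.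
(* At the identity all translates have length 1, where the function vanishes. *)
case: (word g) => [|c w]; first by rewrite big1.
rewrite (sum_letters_push (fun n => (spherical q^-1 n)%:C%C)).
rewrite card_ord sphericalSS -raddfMn -raddfD /= -mulr_natl -/q.
by rewrite mulNr mulrN mulrA divff// mul1r subrr.
Qed.

Lemma spherical_function_Lp p : (2 <= k)%N -> 2 < p -> Lp p spherical_function.
Proof.
move=> k2 p2.
have q1 : 1 < q by rewrite ltr1n; lia.
apply: le_lt_trans (esum_expr_size_lty (T := 'I_k) (x := q^-1 `^ (p / 2)) _ _).
- apply: le_esum => g _.
  rewrite /spherical_function normc_real abse_EFin ger0_norm ?powR_ge0// lee_fin.
  apply: powR_norm_spherical_le; first by rewrite invr_ge0 ltW// (lt_trans _ q1).
  exact: lt_trans p2.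
- exact: powR_ge0.
- by rewrite card_ord powR_inv_mul_lt1.
Qed.

End Chi1.

Theorem mainTheorem4 (R : realType) (k : nat) (hk : (2 <= k)%N) (p : R)
  (hp : 2 < p) :
  p_zero_divisor p (chi1 R k).
Proof.
have k0 : (0 < k)%N by exact: ltnW.
split; [exact: chi1_L1|exact: chi1_neq0|exists (@spherical_function R k); split].
- exact: spherical_function_Lp.
(* The value at the identity is [phi 0 = 1]. *)
- move=> /(congr1 (@^~ 1%g)) /(congr1 (@complex.Re R)) /eqP.
  by rewrite /spherical_function /= /spherical /= expr0 oner_eq0.
- exact: convolution_chi1_spherical.
Qed.
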